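(* Let $N\ge 1$ be an integer, $\sigma\neq 0$ a real constant, and for $r\ge 0$ let $$u(r)=1+\sum_{j=1}^{\infty}\frac{1}{j!\,(N+2)(N+6)\cdots(N+4j-2)}\left(\frac{r^2}{2\sigma^2}\right)^{2j}.$$ Then the function $$r\mapsto \frac{u'(r)}{r\,u(r)}$$ is increasing on $(0,\infty)$, and for all $r>0$ $$\frac{u'(r)}{r\,u(r)}\le \frac{1}{\sigma^2}.$$
   Context: The product $(N+2)(N+6)\cdots(N+4j-2)$ is $\prod_{i=1}^{j}(N+4i-2)$. The function $u$ satisfies $u''(r)+\frac{N-1}{r}u'(r)=\frac{1}{\sigma^4}r^2u(r)$ for $r>0$, with $u(0)=1$, $u'(0)=0$. *)

(* Defs.v *)
(* Stdlib reals with Coquelicot. *)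
From Stdlib Require Import Reals Factorial.
From Coquelicot Require Import Coquelicot.
Open Scope R_scope.

(* (N+2)(N+6)...(N+4j-2) for j >= 1: [prod_f_R0 f n] has the n+1 factors
   f 0, ..., f n, so the i-th factor of the product sits at index i-1. *)
Definition denom_prod (N j : nat) : R :=
  prod_f_R0 (fun i => INR N + 4 * INR (S i) - 2) (pred j).

(* Meaningful for j >= 1. *)
Definition u_term (N : nat) (sigma r : R) (j : nat) : R :=
  / (INR (fact j) * denom_prod N j) * (r ^ 2 / (2 * sigma ^ 2)) ^ (2 * j).

(* [Series] starts at index 0, hence the shift. The formula is even in r, so it
   is used on all of R; only its values at r >= 0 matter. *)
Definition u (N : nat) (sigma r : R) : R :=
  1 + Series (fun k => u_term N sigma r (S k)).

Definition u_quot (N : nat) (sigma r : R) : R :=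
  Derive (u N sigma) r / (r * u N sigma r).

(* Main.v *)
(* With t = r^4/(4 sigma^4), the function u(r) is F(t) for an entire power
   series F solving 4 t F'' + (N+2) F' = F, and F, F' > 0 on [0,oo).
   Put E = F^2 - N F F' - 4 t F'^2. The quotient is r^2 F'(t) / (sigma^4 F(t)),
   and its r-derivative is r E / (sigma^4 F^2). The differential equation gives
   4 t E' + N E = 2 N F F' > 0, so s^N E(s^4) increases from 0 and E > 0. This is
   the monotonicity; moreover E > 0 implies 4 t F'^2 < F^2, which is the bound. *)
Require Import Defs.
From Stdlib Require Import Reals Factorial Lra Lia.
From Coquelicot Require Import Coquelicot.
Open Scope R_scope.

Lemma PSeries_pos (a : nat -> R) (x : R) :
  (forall n, 0 < a n) -> CV_radius a = p_infty -> 0 <= x -> 0 < PSeries a x.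
Proof.
  intros ha hcv hx.
  assert (hex : ex_series (fun n => a n * x ^ n)).
  { apply ex_pseries_R, CV_radius_inside; rewrite hcv; exact I. }
  assert (hpos : forall n, 0 <= a n * x ^ n).
  { intros n; apply Rmult_le_pos; [apply Rlt_le, ha | now apply pow_le]. }
  unfold PSeries; rewrite (Series_incr_1 _ hex).
  (* The zero series is written as a multiple of the tail so that [Series_scal_l] evaluates it. *)
  assert (h : Series (fun n => 0 * (a (S n) * x ^ S n)) <= Series (fun n => a (S n) * x ^ S n)).
  { apply Series_le; [|now apply (ex_series_incr_1 (fun n => a n * x ^ n))].
    intros n; rewrite Rmult_0_l; split; [lra | apply hpos]. }
  rewrite Series_scal_l in h.
  generalize (ha 0%nat); simpl in *; lra.
Qed.

Lemma is_derive_entire (a : nat -> R) (x : R) :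
  CV_radius a = p_infty -> is_derive (PSeries a) x (PSeries (PS_derive a) x).
Proof. intros hcv; apply is_derive_PSeries; rewrite hcv; exact I. Qed.

(** The reciprocal denominators of [u_term] in recursive form: the ratio of consecutive coefficients
    is what both the ratio test and the differential equation need. The value 1 at index 0 absorbs
    the leading 1 of [u]. *)
Fixpoint coef (N j : nat) : R :=
  match j with
  | O => 1
  | S k => coef N k / (INR (S k) * (INR N + 4 * INR k + 2))
  end.

Lemma coef_denom_pos (N k : nat) : 0 < INR (S k) * (INR N + 4 * INR k + 2).
Proof.
  generalize (pos_INR N) (pos_INR k); intros hn hk.
  rewrite S_INR; apply Rmult_lt_0_compat; lra.
Qed.

Lemma coef_pos (N j : nat) : 0 < coef N j.
Proof.
  induction j as [|k IH]; simpl coef; [lra|].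
  apply Rdiv_lt_0_compat; [exact IH | apply coef_denom_pos].
Qed.

Lemma coef_rec (N k : nat) :
  INR (S k) * (INR N + 4 * INR k + 2) * coef N (S k) = coef N k.
Proof.
  generalize (coef_denom_pos N k); intros h.
  change (coef N (S k)) with (coef N k / (INR (S k) * (INR N + 4 * INR k + 2))).
  set (d := INR (S k) * (INR N + 4 * INR k + 2)) in *; field; lra.
Qed.

Lemma denom_prod_pos (N k : nat) : 0 < denom_prod N (S k).
Proof.
  assert (hfac : forall i, 0 < INR N + 4 * INR (S i) - 2).
  { intros i; generalize (pos_INR N) (pos_INR i); rewrite S_INR; lra. }
  unfold denom_prod; simpl pred; induction k as [|k IH]; cbn -[INR].
  - apply hfac.
  - now apply Rmult_lt_0_compat.
Qed.

Lemma coef_denom_prod (N k : nat) :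
  coef N (S k) = / (INR (fact (S k)) * denom_prod N (S k)).
Proof.
  induction k as [|k IH].
  - unfold denom_prod; simpl; generalize (pos_INR N); intros; field; lra.
  - change (coef N (S (S k))) with
      (coef N (S k) / (INR (S (S k)) * (INR N + 4 * INR (S k) + 2))).
    rewrite IH.
    (* The last factor is N + 4(k+2) - 2 = N + 4(k+1) + 2. *)
    assert (hd : denom_prod N (S (S k)) =
      denom_prod N (S k) * (INR N + 4 * INR (S k) + 2)).
    { change (denom_prod N (S (S k))) with
        (denom_prod N (S k) * (INR N + 4 * INR (S (S k)) - 2)).
      rewrite (S_INR (S k)); ring. }
    rewrite hd, (fact_simpl (S k)), mult_INR.
    generalize (denom_prod_pos N k) (INR_fact_neq_0 (S k)) (pos_INR N)
      (pos_INR (S k)) (not_0_INR (S (S k)) (Nat.neq_succ_0 _)).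
    set (f := INR (fact (S k))); set (p := INR (S (S k))); set (q := INR (S k));
      intros; field; repeat split; lra.
Qed.

(** Ratio test: since N + 4n + 2 >= 1, the recurrence bounds c_(n+1) / c_n by 1/(n+1). *)
Lemma CV_radius_coef (N : nat) : CV_radius (coef N) = p_infty.
Proof.
  apply CV_radius_infinite_DAlembert.
  { intros n; generalize (coef_pos N n); lra. }
  apply is_lim_seq_le_le with (u := fun _ => 0) (w := fun n => / INR (S n)).
  - intros n; split; [apply Rabs_pos|].
    generalize (coef_pos N n) (coef_pos N (S n)) (coef_rec N n)
      (pos_INR N) (pos_INR n) (lt_0_INR (S n) (Nat.lt_0_succ n)).
    set (c := coef N n); set (c' := coef N (S n)); set (p := INR (S n)).
    intros hc hc' hrec hN hn hp.
    rewrite Rabs_pos_eq by (apply Rlt_le, Rdiv_lt_0_compat; lra).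
    apply Rmult_le_reg_r with (p * c); [now apply Rmult_lt_0_compat|].
    replace (c' / c * (p * c)) with (p * c') by (field; lra).
    replace (/ p * (p * c)) with c by (field; lra).
    rewrite <- hrec.
    generalize (Rmult_lt_0_compat _ _ hp hc'); nra.
  - apply is_lim_seq_const.
  - apply (is_lim_seq_incr_1 (fun n => / INR n)).
    change (Finite 0) with (Rbar_inv p_infty).
    apply is_lim_seq_inv; [apply is_lim_seq_INR | easy].
Qed.

Definition F (N : nat) : R -> R := PSeries (coef N).
Definition F1 (N : nat) : R -> R := PSeries (PS_derive (coef N)).
Definition F2 (N : nat) : R -> R := PSeries (PS_derive (PS_derive (coef N))).

Lemma is_derive_F (N : nat) (t : R) : is_derive (F N) t (F1 N t).
Proof. apply is_derive_entire, CV_radius_coef. Qed.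

Lemma is_derive_F1 (N : nat) (t : R) : is_derive (F1 N) t (F2 N t).
Proof. apply is_derive_entire; rewrite CV_radius_derive; apply CV_radius_coef. Qed.

Lemma ex_derive_F (N : nat) (t : R) : ex_derive (F N) t.
Proof. eexists; apply is_derive_F. Qed.

Lemma ex_derive_F1 (N : nat) (t : R) : ex_derive (F1 N) t.
Proof. eexists; apply is_derive_F1. Qed.

Lemma Derive_F (N : nat) (t : R) : Derive (fun x => F N x) t = F1 N t.
Proof. apply is_derive_unique, is_derive_F. Qed.

Lemma Derive_F1 (N : nat) (t : R) : Derive (fun x => F1 N x) t = F2 N t.
Proof. apply is_derive_unique, is_derive_F1. Qed.

Lemma F_pos (N : nat) (t : R) : 0 <= t -> 0 < F N t.
Proof. apply PSeries_pos; [apply coef_pos | apply CV_radius_coef]. Qed.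

Lemma F1_pos (N : nat) (t : R) : 0 <= t -> 0 < F1 N t.
Proof.
  apply PSeries_pos; [|rewrite CV_radius_derive; apply CV_radius_coef].
  intros n; apply Rmult_lt_0_compat; [apply lt_0_INR; lia | apply coef_pos].
Qed.

(** Comparing coefficients of t^n: 4n(n+1) c_(n+1) + (N+2)(n+1) c_(n+1) = (n+1)(N+4n+2) c_(n+1),
    which is c_n by [coef_rec]. *)
Lemma F_ode (N : nat) (t : R) : 4 * (t * F2 N t) + (INR N + 2) * F1 N t = F N t.
Proof.
  unfold F, F1, F2.
  rewrite <- PSeries_incr_1, <- !PSeries_scal, <- PSeries_plus.
  - apply PSeries_ext; intros n; rewrite <- coef_rec.
    unfold PS_plus, PS_scal, PS_incr_1, PS_derive.
    (* Multiplication by t shifts the coefficients and puts 0 at index 0, hence the case split. *)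
    destruct n as [|n]; unfold plus, scal, zero, mult; simpl plus; simpl scal;
      unfold mult, zero; cbn -[INR coef]; rewrite ?S_INR; simpl INR; ring.
  - apply CV_radius_inside; rewrite CV_radius_scal, CV_radius_incr_1,
      !CV_radius_derive, CV_radius_coef; [exact I | lra].
  - apply CV_radius_inside; rewrite CV_radius_scal, CV_radius_derive,
      CV_radius_coef; [exact I | generalize (pos_INR N); lra].
Qed.

Lemma u_eq_F (N : nat) (sigma r : R) :
  u N sigma r = F N ((r ^ 2 / (2 * sigma ^ 2)) ^ 2).
Proof.
  unfold u, F, PSeries.
  rewrite (Series_incr_1 (fun k => coef N k * _ ^ k)).
  - apply (f_equal2 Rplus); [simpl; ring|].
    apply Series_ext; intros k.
    unfold u_term; rewrite coef_denom_prod, pow_mult; reflexivity.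
  - apply ex_pseries_R, CV_radius_inside; rewrite CV_radius_coef; exact I.
Qed.

Definition E (N : nat) (t : R) : R :=
  F N t ^ 2 - INR N * F N t * F1 N t - 4 * t * F1 N t ^ 2.

(** In the raw derivative, 2FF' - 4F'^2 - 8tF'F'' collapses to 2NF'^2 by the differential
    equation. *)
Lemma is_derive_E (N : nat) (t : R) :
  is_derive (E N) t (INR N * (F1 N t ^ 2 - F N t * F2 N t)).
Proof.
  unfold E; auto_derive.
  - generalize (ex_derive_F N t) (ex_derive_F1 N t); tauto.
  - rewrite Derive_F, Derive_F1, <- (F_ode N t); ring.
Qed.

(** This is the numerator that differentiating the quotient produces; eliminating F'' by the
    differential equation turns it into [E]. *)
Lemma E_eq (N : nat) (t : R) :
  E N t = 4 * t * (F N t * F2 N t - F1 N t ^ 2) + 2 * F N t * F1 N t.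
Proof. unfold E; generalize (F_ode N t); intros h; nra. Qed.

(** The first summand is 4tE' by [is_derive_E]. It cancels the bracket in N times [E_eq]. *)
Lemma E_ode (N : nat) (t : R) :
  4 * t * (INR N * (F1 N t ^ 2 - F N t * F2 N t)) + INR N * E N t =
  2 * INR N * F N t * F1 N t.
Proof. unfold E; generalize (F_ode N t); intros h; nra. Qed.

(** The natural integrating factor is t^(N/4); putting t = s^4 makes it the integer power s^N, so
    the mean value theorem applies from 0 on. The derivative of s^N E(s^4) is s^(N-1) (4tE' +
    NE). *)
Lemma E_pos (N : nat) (s : R) : (1 <= N)%nat -> 0 < s -> 0 < E N (s ^ 4).
Proof.
  destruct N as [|m]; [lia|]; intros _ hs; set (N := S m).
  destruct (MVT_cor2 (fun x => x ^ N * E N (x ^ 4))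
    (fun x => x ^ m * (2 * INR N * F N (x ^ 4) * F1 N (x ^ 4))) 0 s hs)
    as [c [heq hc]].
  - intros x _; apply is_derive_Reals.
    rewrite <- E_ode; auto_derive.
    + eexists; apply is_derive_E.
    + rewrite (is_derive_unique _ _ _ (is_derive_E N _)).
      unfold N; cbn [pred pow];
        change (match m with O => 1 | S _ => INR m + 1 end) with (INR (S m));
        ring.
  - assert (hc4 : 0 <= c ^ 4) by (apply pow_le; lra).
    assert (h : 0 < s ^ N * E N (s ^ 4)).
    (* The boundary term at 0 vanishes because N is a successor. *)
    { replace (s ^ N * E N (s ^ 4)) with
        (s ^ N * E N (s ^ 4) - 0 ^ N * E N (0 ^ 4)) by (unfold N; simpl; ring).
      rewrite heq.
      repeat apply Rmult_lt_0_compat; try lra; try (apply pow_lt; lra);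
        [apply lt_0_INR; unfold N; lia | now apply F_pos | now apply F1_pos]. }
    apply Rmult_lt_reg_l with (s ^ N); [now apply pow_lt | lra].
Qed.

Lemma Derive_u (N : nat) (sigma r : R) : sigma <> 0 ->
  Derive (u N sigma) r =
  r ^ 3 / sigma ^ 4 * F1 N ((r ^ 2 / (2 * sigma ^ 2)) ^ 2).
Proof.
  intros hs; rewrite (Derive_ext _ _ _ (u_eq_F N sigma)).
  apply is_derive_unique; auto_derive.
  - apply ex_derive_F.
  - rewrite Derive_F.
    cbn [pred pow INR]; rewrite !Rmult_1_r; unfold Rdiv; field; exact hs.
Qed.

Lemma u_quot_eq (N : nat) (sigma r : R) : sigma <> 0 -> 0 < r ->
  u_quot N sigma r =
  r ^ 2 / sigma ^ 4 * F1 N ((r ^ 2 / (2 * sigma ^ 2)) ^ 2) /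
  F N ((r ^ 2 / (2 * sigma ^ 2)) ^ 2).
Proof.
  intros hs hr; unfold u_quot; rewrite (Derive_u _ _ _ hs), u_eq_F.
  generalize (F_pos N _ (pow2_ge_0 (r ^ 2 / (2 * sigma ^ 2)))); intros h.
  field; repeat split; lra.
Qed.

Lemma E_pos_pow2 (N : nat) (q : R) : (1 <= N)%nat -> 0 < q -> 0 < E N (q ^ 2).
Proof.
  intros hN hq.
  replace (q ^ 2) with (sqrt q ^ 4).
  - apply E_pos; [exact hN | now apply sqrt_lt_R0].
  - replace (sqrt q ^ 4) with ((sqrt q ^ 2) ^ 2) by ring.
    rewrite pow2_sqrt; [reflexivity | lra].
Qed.

Theorem lemma3p4 (N : nat) (sigma : R) (hN : (1 <= N)%nat) (hsigma : sigma <> 0) :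
  (forall r s : R, 0 < r -> r < s -> u_quot N sigma r < u_quot N sigma s) /\
  (forall r : R, 0 < r -> u_quot N sigma r <= 1 / sigma ^ 2).
Proof.
  assert (hs2 : 0 < sigma ^ 2) by (apply pow2_gt_0; exact hsigma).
  assert (hs4 : 0 < sigma ^ 4) by
    (replace (sigma ^ 4) with (sigma ^ 2 * sigma ^ 2) by ring; nra).
  assert (hq : forall r, 0 < r -> 0 < r ^ 2 / (2 * sigma ^ 2)).
  { intros r hr; apply Rdiv_lt_0_compat; [now apply pow_lt | lra]. }
  split.
  - intros r s hr hrs.
    rewrite !u_quot_eq by lra.
    set (t := fun x => (x ^ 2 / (2 * sigma ^ 2)) ^ 2).
    apply (incr_function
      (fun x => x ^ 2 / sigma ^ 4 * F1 N (t x) / F N (t x)) 0 p_infty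
      (fun x => x * E N (t x) / (sigma ^ 4 * F N (t x) ^ 2)));
      try easy; intros x hx _; simpl Rbar_lt in hx.
    + generalize (F_pos N (t x) (pow2_ge_0 _)); intros hF.
      unfold t in *; auto_derive.
      * repeat apply conj; try exact I;
          [apply ex_derive_F1 | apply ex_derive_F | simpl in *; lra].
      (* With t = r^4/(4 sigma^4), dt/dr = 4t/r; this is the factor 4t in [E_eq]. *)
      * rewrite Derive_F, Derive_F1, E_eq.
        unfold Rdiv in *; cbn [pred INR pow] in *; rewrite !Rmult_1_r in *.
        field; repeat split; lra.
    + apply Rdiv_lt_0_compat; apply Rmult_lt_0_compat; try easy.
      * now apply E_pos_pow2, hq.
      * apply pow_lt, F_pos, pow2_ge_0.
  - intros r hr; rewrite u_quot_eq by easy.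
    generalize (E_pos_pow2 N _ hN (hq r hr)) (hq r hr).
    (* In terms of q, with t = q^2, the bound reads 2qF'/F <= 1. *)
    assert (hr2 : r ^ 2 / sigma ^ 4 = 2 * (r ^ 2 / (2 * sigma ^ 2)) / sigma ^ 2)
      by (field; exact hsigma).
    rewrite hr2; clear hr2; set (q := r ^ 2 / (2 * sigma ^ 2)); unfold E; intros hE hq0.
    generalize (F_pos N (q ^ 2) (pow2_ge_0 q)) (F1_pos N (q ^ 2) (pow2_ge_0 q))
      (pos_INR N).
    set (f := F N (q ^ 2)) in *; set (f1 := F1 N (q ^ 2)) in *.
    clearbody q f f1; intros hf hf1 hN0.
    (* Dropping N f f1 >= 0 from E > 0 leaves (2 q f1)^2 < f^2, and both bases are nonnegative. *)
    assert (hlt : 2 * q * f1 < f).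
    { assert (0 <= INR N * f * f1) by (repeat apply Rmult_le_pos; lra).
      apply Rsqr_incrst_0; [unfold Rsqr; nra | | lra].
      repeat apply Rmult_le_pos; lra. }
    replace (2 * q / sigma ^ 2 * f1 / f) with (2 * q * f1 / f / sigma ^ 2)
      by (field; lra).
    apply Rmult_le_compat_r; [apply Rlt_le, Rinv_0_lt_compat, hs2|].
    apply Rmult_le_reg_r with f; [exact hf|].
    replace (2 * q * f1 / f * f) with (2 * q * f1) by (field; lra); lra.
Qed.
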